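(* Let $m\ge 1$ be an integer and let $N$ be an integer with $N\notin\{23,37,51\}$. If there exists a $k$-uniform state in $(\mathbb{C}^3)^{\otimes N}$, then $$ k\le \begin{cases} 6m-1, & \text{if } 14m-4\le N\le 14m-1;\\ 6m+1, & \text{if } 14m\le N\le 14m+4;\\ 6m+3, & \text{if } 14m+5\le N\le 14m+9.\end{cases} $$
   Context: For $d\ge 2$, a pure state in $(\mathbb{C}^d)^{\otimes N}$ is a unit vector $|\psi\rangle$, with density matrix $\rho=|\psi\rangle\langle\psi|$. For $A\subseteq[N]=\{1,\dots,N\}$, the reduced density matrix $\rho_A$ is the partial trace of $\rho$ over the tensor factors indexed by $A^c=[N]\setminus A$. The state $|\psi\rangle$ is called $k$-uniform if for every $k$-element subset $A\subseteq[N]$, $\rho_A=\frac{1}{d^k}I$ (the maximally mixed state on the $k$ parties in $A$). *)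

(* Defs.v *)
From HB Require Import structures.
From mathcomp Require Import all_boot all_order all_algebra.
From mathcomp Require Import spectral sesquilinear complex reals.

Set Implicit Arguments.
Unset Strict Implicit.
Unset Printing Implicit Defensive.

Import Order.TTheory GRing.Theory Num.Theory.
Local Open Scope ring_scope.
Local Open Scope sesquilinear_scope.

(* Labels of the computational basis of the tensor product of the local spaces
   C^d over the parties in T. *)
Definition config (d : nat) (T : finType) := {ffun T -> 'I_d}.

(* Vectors of the tensor product, given by their coordinates in the
   computational basis; coordinates are numbered through [enum_rank]. *)
Notation tensor_space C d T := 'cV[C]_#|{: config d T}|.

Notation operator C d T := 'M[C]_#|{: config d T}|.

(* The configuration of all the parties that is a on A and c off A. *)
Definition glue (d N : nat) (A : {set 'I_N})
    (a : config d {i : 'I_N | i \in A}) (c : config d {i : 'I_N | i \notin A}) :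
    config d 'I_N :=
  [ffun i => match boolP (i \in A) with
             | AltTrue iA => a (exist _ i iA)
             | AltFalse iNA => c (exist _ i iNA)
             end].

Section States.
Variables (C : numClosedFieldType) (d N : nat).

Definition pure_state (psi : tensor_space C d 'I_N) : Prop :=
  \sum_x `|psi x 0| ^+ 2 = 1.

Definition density (psi : tensor_space C d 'I_N) : operator C d 'I_N :=
  psi *m psi ^t*.

(* Partial trace over the parties outside A. *)
Definition reduced (A : {set 'I_N}) (rho : operator C d 'I_N) :
    operator C d {i : 'I_N | i \in A} :=
  \matrix_(a, b) \sum_(c : config d {i : 'I_N | i \notin A})
    rho (enum_rank (glue (enum_val a) c)) (enum_rank (glue (enum_val b) c)).

(* For k > N the quantification is empty: k <= N has to be required separately. *)
Definition k_uniform (k : nat) (psi : tensor_space C d 'I_N) : Prop :=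
  forall A : {set 'I_N}, #|A| = k ->
    reduced A (density psi) = (1 / d%:R ^+ k)%:M.

End States.

(* Main.v *)
Require Import Defs.
From mathcomp Require Import all_boot all_order all_algebra.
From mathcomp Require Import complex reals.
From mathcomp Require Import ring lra zify ssrZ.

(* Let pi_S be the purity of the reduction of psi to S, which is the expectation
   of the swap F_S in psi (x) psi. Decomposing each pair of parties into its
   symmetric and antisymmetric parts gives nonnegative q_T, vanishing for #|T|
   odd, with
     2^N sum_S pi_S z^#|S| = sum_T q_T (1 + z)^(N - #|T|) (1 - z)^#|T|.
   Since (1 - z)^2 = (1 + z)^2 - 4 z, this polynomial is (1 + z)^N P(w) with
   w = z / (1 + z)^2, and the coefficient of w^j in P has the sign of (-1)^j.
   If psi is j-uniform, then pi_S = 3^-#|S| for #|S| <= j, which determines that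
   coefficient: with z = 3t it is a negative multiple of the coefficient of
   t^n in (1 + t)^(2n + e) (1 + 3t)^-e, where n = j - 1 and e = N + 1 - 2j. For
   even j this number is therefore nonpositive. On the other hand it is positive
   for j = 6m, 6m + 2, 6m + 4 and N in the respective range: its contiguity
   relations, restricted to the direction (n, e) -> (n + 3, e + 1), preserve a
   cone that is entered at (n, e) = (24, 9), and the finitely many cases left
   are computed. *)

Set Implicit Arguments.
Unset Strict Implicit.
Unset Printing Implicit Defensive.

Import Order.TTheory GRing.Theory Num.Theory.
Local Open Scope ring_scope.

(** * Truncated power series and their recurrences *)

Lemma coefM_low0 (R : nzRingType) (p q : {poly R}) n :
  (forall i, (i <= n)%N -> q`_i = 0) -> (p * q)`_n = 0.
Proof. by move=> q0; rewrite coefM big1 // => i _; rewrite q0 ?leq_subr ?mulr0. Qed.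

Lemma mul_deriv_exp (R : comNzRingType) (p : {poly R}) n :
  p * (p ^+ n)^`() = n%:R * (p^`() * p ^+ n).
Proof.
rewrite deriv_exp -mulr_natl; case: n => [|n]; first by rewrite !mul0r mulr0.
by rewrite exprS /=; ring.
Qed.

Section Series.
Variables (R : comNzRingType) (J : nat).

(* The inverse of 1 + 3X modulo X^J. *)
Definition geom : {poly R} := \sum_(i < J) (- ('X *+ 3)) ^+ i.

(* (1 + X)^M / (1 + 3X)^e modulo X^J. *)
Definition ser (M e : nat) : {poly R} := (1 + 'X) ^+ M * geom ^+ e.

Lemma mul_geom : (1 + 'X *+ 3) * geom = 1 - (- ('X *+ 3)) ^+ J.
Proof.
have := subrX1 (- ('X *+ 3) : {poly R}) J; rewrite -/geom => e.
by rewrite -[RHS]opprB e; ring.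
Qed.

Lemma coef_mul_geom n : (n < J)%N -> ((1 + 'X *+ 3) * geom - 1)`_n = 0.
Proof.
move=> nJ; rewrite mul_geom addrAC subrr add0r coefN -mulNrn -mulr_natr.
by rewrite exprMn exprNn -natrX mulr_natr coefMn mulrC coefXnM nJ mul0rn oppr0.
Qed.

Lemma coef_mul_deriv_geom n : (n.+1 < J)%N ->
  ((1 + 'X *+ 3) * geom^`() + geom *+ 3)`_n = 0.
Proof.
move=> nJ.
have -> : (1 + 'X *+ 3) * geom^`() + geom *+ 3 =
          ((1 + 'X *+ 3) * geom - 1)^`().
  rewrite derivB derivM derivD !derivC derivMn derivX.
  by ring.
by rewrite coef_deriv coef_mul_geom // mul0rn.
Qed.

Lemma serS M e : ser M.+1 e = (1 + 'X) * ser M e.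
Proof. by rewrite /ser exprS mulrA. Qed.

(** [geom] inverts 1 + 3X only modulo X^J: each cancelled pair costs a multiple of (1 + 3X) [geom] -
    1, which is invisible below degree J. *)
Lemma coef_geom_cancel (p : {poly R}) a e n : (n < J)%N ->
  (p * (1 + 'X *+ 3) ^+ a * geom ^+ (a + e))`_n = (p * geom ^+ e)`_n.
Proof.
move=> nJ; elim: a p => [|a IH] p; first by rewrite expr0 mulr1.
rewrite -[RHS]IH -[LHS]subr0.
rewrite -[X in _ - X](@coefM_low0 _ (p * (1 + 'X *+ 3) ^+ a * geom ^+ (a + e))
  ((1 + 'X *+ 3) * geom - 1) n); last first.
  by move=> i le_in; rewrite coef_mul_geom ?(leq_ltn_trans le_in).
by rewrite -coefB; congr (nth _ (polyseq _) _); rewrite addSn !exprS; ring.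
Qed.

Lemma coef_serS M e n : (n < J)%N ->
  ((1 + 'X *+ 3) * ser M e.+1)`_n = (ser M e)`_n.
Proof.
move=> nJ; rewrite -(coef_geom_cancel ((1 + 'X) ^+ M) 1 e nJ) /ser expr1 add1n.
by congr (nth _ (polyseq _) _); ring.
Qed.

(* Coefficientwise form of
   (1 + X)(1 + 3X) f' = (M (1 + 3X) - 3e (1 + X)) f. *)
Lemma ser_rec M e n : (n.+1 < J)%N ->
  n.+1%:R * (ser M e)`_n.+1 =
  (M%:R - 3 * e%:R - 4 * n%:R) * (ser M e)`_n
  + 3 * (M%:R - e%:R - n%:R + 1) * ('X * ser M e)`_n.
Proof.
move=> nJ; set f := ser M e.
(* The last summand is the truncation error; its coefficients vanish below degree J - 1. *)
have ode : (1 + 'X) * (1 + 'X *+ 3) * f^`() =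
  M%:R * (1 + 'X *+ 3) * f - (3 * e%:R) * (1 + 'X) * f
  + (e%:R * (1 + 'X) * (1 + 'X) ^+ M * geom ^+ e.-1)
    * ((1 + 'X *+ 3) * geom^`() + geom *+ 3).
  rewrite /f /ser derivM.
  have := mul_deriv_exp (1 + 'X : {poly R}) M.
  rewrite derivD derivC derivX add0r => dM.
  rewrite (deriv_exp geom) -[_ *+ e]mulr_natl.
  have -> : (1 + 'X) * (1 + 'X *+ 3) *
    (((1 + 'X) ^+ M)^`() * geom ^+ e + (1 + 'X) ^+ M * (e%:R * (geom^`() * geom ^+ e.-1)))
   = (1 + 'X *+ 3) * ((1 + 'X) * ((1 + 'X) ^+ M)^`()) * geom ^+ e +
     (1 + 'X) * (1 + 'X *+ 3) * ((1 + 'X) ^+ M * (e%:R * (geom^`() * geom ^+ e.-1))).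
    by ring.
  rewrite dM; case: e {f} => [|e] /=; first by rewrite expr0; ring.
  by rewrite (exprS geom); ring.
have dX (p : {poly R}) i : ('X * p^`())`_i = i%:R * p`_i.
  by rewrite coefXM; case: i => [|i]; rewrite ?mul0r //= coef_deriv mulr_natl.
have dXX : ('X * ('X * f^`()))`_n = (n%:R - 1) * ('X * f)`_n.
  rewrite coefXM [in RHS]coefXM; case: n {nJ} => [|n]; rewrite ?mulr0 //= dX.
  by rewrite -natr1 addrK.
have := congr1 (fun p : {poly R} => p`_n) ode.
rewrite /= [in RHS]coefD [X in _ = _ + X]coefM_low0 => [|i le_in]; last first.
  by rewrite coef_mul_deriv_geom // (leq_ltn_trans _ nJ).
have -> : (1 + 'X) * (1 + 'X *+ 3) * f^`() =
  f^`() + ('X * f^`()) *+ 4 + ('X * ('X * f^`())) *+ 3 by ring.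
have -> : M%:R * (1 + 'X *+ 3) * f - 3 * e%:R * (1 + 'X) * f =
  f *+ M + ('X * f) *+ (3 * M) - f *+ (3 * e) - ('X * f) *+ (3 * e).
  by ring.
rewrite addr0 !(coefB, coefD, coefMn) dX dXX coef_deriv.
rewrite -[_ *+ n.+1]mulr_natl => H.
by apply/subr0_eq; move/eqP: H; rewrite -subr_eq0 => /eqP H; rewrite -[RHS]H; ring.
Qed.
End Series.

Definition diag_coef (R : comNzRingType) (J n e : nat) : R := (ser R J (2 * n + e) e)`_n.

(** * Positivity of the critical coefficients *)

Section Bracket.
Variables (F : realFieldType) (J : nat).
Local Notation B := (diag_coef F J).

Let coef_1X (p : {poly F}) n : ((1 + 'X) * p)`_n = p`_n + ('X * p)`_n.
Proof. by rewrite mulrDl mul1r coefD. Qed.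

Let coef_13X (p : {poly F}) n : ((1 + 'X *+ 3) * p)`_n = p`_n + 3 * ('X * p)`_n.
Proof. by rewrite mulrDl mul1r coefD [in LHS]mulrnAl coefMn mulr_natl. Qed.

Let coefXS (p : {poly F}) n : ('X * p)`_n.+1 = p`_n.
Proof. by rewrite coefXM. Qed.

(** With h = [ser (2n + e) e.+1], the values at (n, e) and (n, e + 1) are the n-th coefficients of
    (1 + 3X) h and (1 + X) h, and [ser_rec] for h links them. The contiguity relations below arise
    likewise, from common factors of neighbouring series. *)
Lemma diag_coef_pred n e : (n < J)%N ->
  (2 * n%:R + e%:R + 1) * B n e =
  (n%:R + e%:R + 1) * B n e.+1
  + 3 * (n%:R + 1) * ('X * ser F J (2 * n + e.+1) e.+1)`_n.
Proof.
move=> nJ; rewrite /diag_coef -coef_serS // addnS serS coef_13X coef_1X.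
case: n nJ => [|n] nJ; first by rewrite !coefXM /= mulr0n; ring.
have := ser_rec F (2 * n.+1 + e) e.+1 nJ.
set h := ser _ _ _ _; rewrite !coefXS coef_1X.
rewrite natrD natrM -?(natr1 n) -?(natr1 e); lra.
Qed.

Lemma diag_coef_succ n e : (n.+1 < J)%N ->
  3 * (n%:R + 1) * B n.+1 e.+1 =
  (8 * n%:R + 4 * e%:R + 4) * B n e - (4 * n%:R + 10 * e%:R + 4) * B n e.+1.
Proof.
move=> nJ; have := diag_coef_pred e (ltnW nJ); have := ser_rec F (2 * n + e.+1) e.+1 nJ.
rewrite [in B n.+1 _]/diag_coef (_ : 2 * n.+1 + e.+1 = (2 * n + e.+1).+2)%N; last lia.
rewrite !serS coef_1X coefXS !coef_1X coefXS natrD natrM -?(natr1 n) -?(natr1 e) -!/(B n e.+1).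
lra.
Qed.

Lemma diag_coef_succ_pred n e : (n.+1 < J)%N ->
  (n%:R + 1) * B n.+1 e =
  (4 * n%:R + 2 * e%:R + 2) * B n e - 4 * e%:R * B n e.+1.
Proof.
move=> nJ; have := diag_coef_pred e (ltnW nJ); have := ser_rec F (2 * n + e.+1) e.+1 nJ.
rewrite [in B n.+1 _]/diag_coef -(coef_serS F _ e) // (_ : 2 * n.+1 + e = (2 * n + e.+1).+1)%N; last lia.
rewrite serS coef_13X coefXS !coef_1X coefXS natrD natrM -?(natr1 n) -?(natr1 e) -!/(B n e.+1).
lra.
Qed.

Lemma diag_coef_pred2 n e : (n < J)%N ->
  (2 * n%:R + e%:R + 1) * B n e =
  4 * (n%:R + e%:R + 1) * B n e.+1 - 3 * (e%:R + 1) * B n e.+2.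
Proof.
move=> nJ; have := diag_coef_pred e nJ; have := diag_coef_pred e.+1 nJ.
have := coef_serS F (2 * n + e.+2) e.+1 nJ.
rewrite {2}addnS serS coef_1X coef_13X /diag_coef.
set f := ser _ _ _ e.+1; set f' := ser _ _ _ e.+2.
move=> H; have -> : ('X * f)`_n = f'`_n + 3 * ('X * f')`_n - f`_n by rewrite H; ring.
rewrite -?(natr1 n) -?(natr1 e); lra.
Qed.
End Bracket.

(* 3^n n! times (diag_coef n e, diag_coef n e.+1), computable over Z. *)
Fixpoint scaled_diag (R : pzRingType) (e n : nat) : R * R :=
  if n is m.+1 then
    let: (u, v) := scaled_diag R e m in
    (3 * ((4 * m%:R + 2 * e%:R + 2) * u - 4 * e%:R * v),
     (8 * m%:R + 4 * e%:R + 4) * u - (4 * m%:R + 10 * e%:R + 4) * v)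
  else (1, 1).

Lemma scaled_diag_map (R S : pzRingType) (f : {rmorphism R -> S}) e n :
  scaled_diag S e n = (f (scaled_diag R e n).1, f (scaled_diag R e n).2).
Proof.
elim: n => [|n IH] /=; first by rewrite rmorph1.
rewrite IH; case: (scaled_diag R e n) => u v /=.
by rewrite !(rmorphB, rmorphM, rmorphD, rmorph_nat, rmorph1).
Qed.

(** * Cones preserved by the contiguity relations *)

Section Positivity.
Variables (F : realFieldType) (J : nat).
Local Notation B := (diag_coef F J).

Definition ratio_le1 n e := 0 < B n e.+1 <= B n e.

(** Bounding [B n e.+2] by [B n e.+1] makes the right side of [diag_coef_pred2] at least (4n + e +
    1) [B n e.+1]. So only the largest e has to be examined. *)
Lemma ratio_le1_pred n e : (n < J)%N -> ratio_le1 n e.+1 -> ratio_le1 n e.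
Proof.
move=> nJ /andP[v0 vu]; rewrite /ratio_le1 (lt_le_trans v0 vu) /=.
have n0 := ler0n F n; have e0 := ler0n F e.
have D0 : 0 < 2 * n%:R + e%:R + 1 :> F by lra.
rewrite -(ler_pM2l D0) diag_coef_pred2 //.
have := mulr_ge0 e0 (_ : 0 <= B n e.+1 - B n e.+2).
have := mulr_ge0 n0 (ltW (lt_le_trans v0 vu)).
rewrite subr_ge0 => H1 /(_ vu) H2; lra.
Qed.

(** As u >= v, [diag_coef_succ] gives at least (4n - 6e) v, which is positive exactly when 3e <
    2n. *)
Lemma ratio_le1_succ n e : (n.+1 < J)%N -> (3 * e < 2 * n)%N -> ratio_le1 n e -> ratio_le1 n.+1 e.
Proof.
move=> nJ en /andP[v0 vu].
have n0 := ler0n F n; have e0 := ler0n F e.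
have en1 : 3 * e%:R + 1 <= 2 * n%:R :> F.
  by rewrite -!natrM natr1 ler_nat.
have D0 : 0 < 3 * (n%:R + 1) :> F by lra.
have := diag_coef_succ F e nJ; have := diag_coef_succ_pred F e nJ.
rewrite /ratio_le1 -(pmulr_rgt0 _ D0) -(ler_pM2l D0) => Hu Hv.
move: (B n e) (B n e.+1) (B n.+1 e) (B n.+1 e.+1) v0 vu Hu Hv => u v u' v' v0 vu Hu Hv.
have H1 := mulr_ge0 n0 (ltW v0); have H2 := mulr_ge0 e0 (ltW v0).
have H3 : 0 <= n%:R * (u - v) by rewrite mulr_ge0 ?subr_ge0.
have H4 : 0 <= e%:R * (u - v) by rewrite mulr_ge0 ?subr_ge0.
have H5 : 0 <= (2 * n%:R - 3 * e%:R - 1) * v by rewrite mulr_ge0 ?(ltW v0) //; lra.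
apply/andP; split; last lra.
by rewrite Hv; lra.
Qed.

(* The transfer matrix of three steps in n and one in e has one negative
   eigenvalue, of modulus about 0.9 times the dominant one; the slope 7/8 lies
   in the narrow range (about 0.85 to 0.90) for which the cone is invariant. *)
Lemma ratio_le78_step_alg (x u v u1 v1 u2 v2 u3 v3 w : F) : 8 <= x ->
  3 * (3 * x + 1) * v1 = (28 * x + 4) * u - (22 * x + 4) * v ->
  (3 * x + 1) * u1 = (14 * x + 2) * u - 4 * x * v ->
  3 * (3 * x + 2) * v2 = (28 * x + 12) * u1 - (22 * x + 8) * v1 ->
  (3 * x + 2) * u2 = (14 * x + 6) * u1 - 4 * x * v1 ->
  3 * (3 * x + 3) * v3 = (28 * x + 20) * u2 - (22 * x + 12) * v2 ->
  (3 * x + 3) * u3 = (14 * x + 10) * u2 - 4 * x * v2 ->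
  3 * w = 16 * v3 - 7 * u3 ->
  0 < v -> 8 * v <= 7 * u -> 0 < w /\ 8 * w <= 7 * v3.
Proof.
move=> x8 v1E u1E v2E u2E v3E u3E wE v0 vu.
set d := (3 * (3 * x + 1)) * (3 * (3 * x + 2)) * (3 * (3 * x + 3)).
have d0 : 0 < d by rewrite !mulr_gt0 //; lra.
have n1 : 3 * x + 1 != 0 by apply: lt0r_neq0; lra.
have n2 : 3 * x + 2 != 0 by apply: lt0r_neq0; lra.
have n3 : 3 * x + 3 != 0 by apply: lt0r_neq0; lra.
have div (a b c : F) : a != 0 -> a * b = c -> b = c / a.
  by move=> a0 <-; rewrite mulrAC divff // mul1r.
have n31 a : a != 0 -> 3 * a != 0 :> F by move=> a0; rewrite mulf_neq0 // pnatr_eq0.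
move/(div _ _ _ (n31 _ n1)) in v1E; move/(div _ _ _ n1) in u1E.
move/(div _ _ _ (n31 _ n2)) in v2E; move/(div _ _ _ n2) in u2E.
move/(div _ _ _ (n31 _ n3)) in v3E; move/(div _ _ _ n3) in u3E.
have Hw : d * (16 * v3 - 7 * u3) =
    ((1000 * 69 + 832) * x ^+ 3 + (1000 * 100 + 920) * x ^+ 2
     + (1000 * 42 + 392) * x + (1000 * 4 + 200)) * u
  - ((1000 * 76 + 624) * x ^+ 3 + (1000 * 112 + 848) * x ^+ 2
     + (1000 * 50 + 96) * x + (1000 * 6 + 144)) * v.
  by rewrite /d v3E u3E v2E u2E v1E u1E; field; rewrite n1 n2 n3.
(* By [wE], 8w <= 7 v3 amounts to 107 v3 <= 56 u3, where 107 = 128 - 21. *)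
have Hz : d * (56 * u3 - 107 * v3) =
    ((1000 * 22 + 288) * x ^+ 3 + (1000 * 49 + 440) * x ^+ 2
     + (1000 * 18 + 368) * x + (1000 * 1 + 680)) * u
  + ((1000 * 403 + 496) * x ^+ 3 + (1000 * 610 + 464) * x ^+ 2
     + (1000 * 285 + 184) * x + (1000 * 41 + 88)) * v.
  by rewrite /d v3E u3E v2E u2E v1E u1E; field; rewrite n1 n2 n3.
clear v1E u1E v2E u2E v3E u3E n1 n2 n3 n31 div; clearbody d.
have u0 : 0 < u by lra.
have x0 : 0 <= x - 8 by lra.
(* Written in x - 8, v and y = 7u - 8v, both forms have nonnegative coefficients, so these products
   suffice for [lra]. *)
have [X1 X2 X3] : [/\ 0 <= (x - 8) * v, 0 <= (x - 8) ^+ 2 * v & 0 <= (x - 8) ^+ 3 * v].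
  by split; rewrite !mulr_ge0 ?exprn_ge0 ?(ltW v0).
set y := 7 * u - 8 * v; have y0 : 0 <= y by rewrite /y; lra.
have [Y1 Y2 Y3] : [/\ 0 <= (x - 8) * y, 0 <= (x - 8) ^+ 2 * y & 0 <= (x - 8) ^+ 3 * y].
  by split; rewrite !mulr_ge0 ?exprn_ge0.
have w0 : 0 < 16 * v3 - 7 * u3.
  by rewrite -(pmulr_rgt0 _ d0) Hw; rewrite /y in y0 Y1 Y2 Y3; lra.
have z0 : 0 <= 56 * u3 - 107 * v3.
  by rewrite -(pmulr_rge0 _ d0) Hz; rewrite /y in y0 Y1 Y2 Y3; lra.
by split; lra.
Qed.

Definition ratio_le78 n e := 0 < B n e.+1 /\ 8 * B n e.+1 <= 7 * B n e.

Lemma ratio_le78_step e : (8 <= e)%N -> (3 * e.+1 < J)%N ->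
  ratio_le78 (3 * e) e -> ratio_le78 (3 * e.+1) e.+1.
Proof.
move=> e8 eJ [v0 vu]; rewrite /ratio_le78.
have [J1 J2 J3] : [/\ (3 * e).+1 < J, (3 * e).+2 < J & (3 * e).+3 < J]%N by split; lia.
have x8 : 8 <= e%:R :> F by rewrite ler_nat.
have := diag_coef_pred2 F e J3.
have := diag_coef_succ_pred F e J3; have := diag_coef_succ F e J3.
have := diag_coef_succ_pred F e J2; have := diag_coef_succ F e J2.
have := diag_coef_succ_pred F e J1; have := diag_coef_succ F e J1.
rewrite (_ : 3 * e.+1 = (3 * e).+3)%N; last lia.
have S1 : (3 * e).+1%:R = 3 * e%:R + 1 :> F by rewrite -natr1 natrM.
have S2 : (3 * e).+2%:R = 3 * e%:R + 2 :> F by rewrite -natr1 S1; ring.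
have S3 : (3 * e).+3%:R = 3 * e%:R + 3 :> F by rewrite -natr1 S2; ring.
rewrite S1 S2 S3 natrM => v1E u1E v2E u2E v3E u3E wE.
have xn0 : e%:R + 1 != 0 :> F by apply: lt0r_neq0; lra.
apply: (@ratio_le78_step_alg e%:R (B (3 * e) e) (B (3 * e) e.+1)
  (B (3 * e).+1 e) (B (3 * e).+1 e.+1) (B (3 * e).+2 e) (B (3 * e).+2 e.+1)
  (B (3 * e).+3 e) (B (3 * e).+3 e.+1) (B (3 * e).+3 e.+2)) => //.
- by rewrite v1E; ring.
- by rewrite u1E; ring.
- by rewrite (_ : 3 * e%:R + 2 = 3 * e%:R + 1 + 1) 1?v2E; ring.
- by rewrite (_ : 3 * e%:R + 2 = 3 * e%:R + 1 + 1) 1?u2E; ring.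
- by rewrite (_ : 3 * e%:R + 3 = 3 * e%:R + 2 + 1) 1?v3E; ring.
- by rewrite (_ : 3 * e%:R + 3 = 3 * e%:R + 2 + 1) 1?u3E; ring.
(* At (3e + 3, e) the relation [diag_coef_pred2] is e + 1 times 7 u3 = 16 v3 - 3w. *)
- by apply: (mulfI xn0); lra.
Qed.

Lemma scaled_diagP n e : (n < J)%N ->
  exists2 d : F, 0 < d & scaled_diag F e n = (d * B n e, d * B n e.+1).
Proof.
elim: n => [|n IH] nJ.
  have B0 a : B 0 a = 1.
    have G0 : (geom F J).[0] = 1.
      rewrite /geom; case: J nJ => // j _; rewrite big_ord_recl expr0.
      rewrite hornerD horner_sum hornerC big1 ?addr0 // => k _.
      by rewrite horner_exp hornerN hornerMn hornerX mul0rn oppr0 expr0n.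
    by rewrite /diag_coef -horner_coef0 hornerM !horner_exp G0 hornerD hornerX hornerC addr0 !expr1n mulr1.
  by exists 1; rewrite ?ltr01 //= !B0 !mulr1.
have [d d0 /= ->] := IH (ltnW nJ).
exists (3 * (n%:R + 1) * d); first by rewrite !mulr_gt0 // ltr_wpDl.
have B1 := diag_coef_succ F e nJ; have B2 := diag_coef_succ_pred F e nJ.
have -> : 3 * (n%:R + 1) * d * B n.+1 e = 3 * d * ((n%:R + 1) * B n.+1 e) by ring.
have -> : 3 * (n%:R + 1) * d * B n.+1 e.+1 = d * (3 * (n%:R + 1) * B n.+1 e.+1) by ring.
by rewrite B1 B2; congr (_, _); ring.
Qed.

Local Notation Z := BinNums.Z.
Let Zr (z : Z) : F := (int_of_Z z)%:~R.

Let ler_Zr (x y : Z) : (Zr x <= Zr y) = (x <= y).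
Proof. by rewrite ler_int; lia. Qed.

Let ltr_Zr (x y : Z) : (Zr x < Zr y) = (x < y).
Proof. by rewrite ltr_int; lia. Qed.

(** The scaling factor is positive, so inequalities decided by computation over Z pass to F. *)
Lemma scaled_diag_ge a b n e : (n < J)%N ->
  (let: (u, v) := scaled_diag Z e n in (0 < v) && (a%:R * v <= b%:R * u)) ->
  0 < B n e.+1 /\ a%:R * B n e.+1 <= b%:R * B n e.
Proof.
move=> nJ; have [d d0] := scaled_diagP e nJ.
rewrite (scaled_diag_map (intmul 1 \o int_of_Z : {rmorphism Z -> F})).
case: (scaled_diag _ e n) => u v /= [] uE vE /andP[].
rewrite -(ltr_Zr 0) -ler_Zr /Zr !rmorphM !rmorph_nat /= uE vE rmorph0.
rewrite (pmulr_rgt0 _ d0) => -> H; split=> //.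
by rewrite -(ler_pM2l d0) mulrCA [leRHS]mulrCA.
Qed.

Lemma scaled_ratio_le1 n e : (n < J)%N ->
  (let: (u, v) := scaled_diag Z e n in (0 < v) && (1%:R * v <= 1%:R * u)) -> ratio_le1 n e.
Proof.
by move=> nJ /(scaled_diag_ge nJ)[v0]; rewrite !mul1r /ratio_le1 v0.
Qed.

Lemma ratio_le78_all e : (8 <= e)%N -> (3 * e < J)%N -> ratio_le78 (3 * e) e.
Proof.
elim: e => // e IH; rewrite leq_eqVlt => /predU1P[<- eJ|e8 eJ].
  by apply: (@scaled_diag_ge 8 7 24 8) => //; vm_compute.
by apply: ratio_le78_step => //; apply: IH => //; lia.
Qed.

Lemma ratio_le78_le1 e : (8 <= e)%N -> (3 * e < J)%N -> ratio_le1 (3 * e) e.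
Proof.
move=> e8 eJ; have [v0 vu] := ratio_le78_all e8 eJ.
by rewrite /ratio_le1 v0 /=; lra.
Qed.

Lemma ratio_le1_gt0 n e e' : (n < J)%N -> ratio_le1 n e -> (0 < e' <= e.+1)%N -> 0 < B n e'.
Proof.
move=> nJ; elim: e e' => [|e IH] e' g.
  by case: e' => [|[|]] // _; case/andP: g.
move=> /andP[e0 le_e]; have [lt_e|ge_e] := ltnP e' e.+2.
  by apply: IH; [apply: ratio_le1_pred | rewrite e0].
by rewrite (_ : e' = e.+2); last lia; case/andP: g.
Qed.

(** For j = 6m the index is e = N + 1 - 12m, at most 2m when N <= 14m - 1. The point (6m - 1, 2m -
    1) is two steps in n beyond the line n = 3e, on which the narrow cone holds from e = 8 on. *)
Lemma diag_coef_6mB1_gt0 m e : (0 < m)%N -> (6 * m - 1 < J)%N -> (0 < e <= 2 * m)%N ->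
  0 < B (6 * m - 1) e.
Proof.
move=> m0 nJ em; apply: (@ratio_le1_gt0 _ (2 * m - 1) _ nJ); last lia.
have [m5|] := leqP 5 m.
  rewrite (_ : 6 * m - 1 = (3 * (2 * m - 1)).+2)%N; last lia.
  by rewrite !(ratio_le1_succ, ratio_le78_le1) //; lia.
case: m m0 nJ {em} => [|[|[|[|[|m]]]]] // _ nJ _; apply: scaled_ratio_le1 nJ _; by vm_compute.
Qed.

(** Here j = 6m + 2 and e = N - 12m - 3; the point (6m + 1, 2m) is one step beyond the line n =
    3e. *)
Lemma diag_coef_6mD1_gt0 m e : (0 < m)%N -> (6 * m + 1 < J)%N -> (0 < e <= 2 * m + 1)%N ->
  0 < B (6 * m + 1) e.
Proof.
move=> m0 nJ em; apply: (@ratio_le1_gt0 _ (2 * m) _ nJ); last lia.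
have [m4|] := leqP 4 m.
  rewrite (_ : 6 * m + 1 = (3 * (2 * m)).+1)%N; last lia.
  by rewrite !(ratio_le1_succ, ratio_le78_le1) //; lia.
case: m m0 nJ {em} => [|[|[|[|m]]]] // _ nJ _; apply: scaled_ratio_le1 nJ _; by vm_compute.
Qed.

(** Here j = 6m + 4 and e = N - 12m - 7; the point (6m + 3, 2m + 1) lies on the line n = 3e. For m
    <= 3 the cone is checked at 2m instead, which leaves out e = 2m + 2, that is N = 14m + 9. *)
Lemma diag_coef_6mD3_gt0 m e : (0 < m)%N -> (6 * m + 3 < J)%N -> (0 < e <= 2 * m + 2)%N ->
  (m <= 3 -> e <= 2 * m + 1)%N -> 0 < B (6 * m + 3) e.
Proof.
move=> m0 nJ em; have [m4 _|m4 /(_ m4) em'] := leqP 4 m.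
  apply: (@ratio_le1_gt0 _ (2 * m + 1) _ nJ); last lia.
  rewrite (_ : 6 * m + 3 = 3 * (2 * m + 1))%N; last lia.
  by rewrite ratio_le78_le1 //; lia.
apply: (@ratio_le1_gt0 _ (2 * m) _ nJ); last lia.
case: m m0 nJ m4 {em em'} => [|[|[|[|m]]]] // _ nJ _; apply: scaled_ratio_le1 nJ _; by vm_compute.
Qed.
End Positivity.

(** * The dual functional *)

Lemma coef_exp_1p3X (R : comNzRingType) n i :
  ((1 + 'X *+ 3 : {poly R}) ^+ n)`_i = 'C(n, i)%:R * 3 ^+ i.
Proof.
rewrite exprDn coef_sum.
under eq_bigr => k _.
  rewrite expr1n mul1r exprMn_n !coefMn coefXn -mulrnA -[_ *+ _]mulr_natl mulnC natrM natrX.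
  over.
have [le_in|lt_ni] := leqP i n.
  rewrite (bigD1 (Ordinal (le_in : (i < n.+1)%N))) //= eqxx mulr1 big1 ?addr0 1?mulrC //.
  by move=> k; rewrite -val_eqE /= eq_sym => /negPf->; rewrite mulr0.
rewrite bin_small // mul0r big1 // => k _.
by rewrite gtn_eqF ?mulr0 // (leq_trans (ltn_ord k)).
Qed.

Section Functional.
Variables (C : numFieldType) (J j e : nat).
Hypotheses (jJ : (j < J)%N) (j0 : (0 < j)%N).
Local Notation N := (2 * j + e)%N.

(* By Lagrange inversion with w = X / (1 + 3X)^2, this reads off the
   coefficient of w^j in p (1 + 3X)^-N; see [dual_coef_basis]. *)
Definition dual_coef (p : {poly C}) : C := (p * (1 - 'X *+ 3) * geom C J ^+ e.+1)`_j.

Lemma dual_coef_sum (I : finType) (p : I -> {poly C}) :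
  dual_coef (\sum_i p i) = \sum_i dual_coef (p i).
Proof. by rewrite /dual_coef !mulr_suml coef_sum. Qed.

Lemma dual_coefZ a (p : {poly C}) : dual_coef (a *: p) = a * dual_coef p.
Proof. by rewrite /dual_coef -!scalerAl coefZ. Qed.

Lemma dual_coef_eq (p q : {poly C}) : (forall i, (i <= j)%N -> p`_i = q`_i) -> dual_coef p = dual_coef q.
Proof.
move=> pq; rewrite /dual_coef -!mulrA !coefM; apply: eq_bigr => i _.
by rewrite pq // -ltnS.
Qed.

(** For i < j, with r = j - i, cancelling leaves the coefficient of X^r in (1 - 3X)(1 + 3X)^(2r -
    1). As 1 - 3X = 2 - (1 + 3X), it is 3^r (2 C(2r - 1, r) - C(2r, r)) = 0. For i > j the factor
    X^i kills the coefficient. *)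
Lemma dual_coef_basis i : (2 * i <= N)%N ->
  dual_coef ('X^i * (1 + 'X *+ 3) ^+ (N - 2 * i)) = (i == j)%:R.
Proof.
move=> iN; rewrite /dual_coef; case: ltngtP => [lt_ij|lt_ji|->].
- rewrite (_ : N - 2 * i = (2 * (j - i) - 1) + e.+1)%N; last lia.
  pose A : {poly C} := 'X^i * (1 - 'X *+ 3) * (1 + 'X *+ 3) ^+ (2 * (j - i) - 1).
  transitivity ((A * (1 + 'X *+ 3) ^+ e.+1 * geom C J ^+ (e.+1 + 0))`_j).
    by congr (nth _ (polyseq _) _); rewrite /A addn0 exprD; ring.
  rewrite coef_geom_cancel // expr0 mulr1 /A.
  rewrite -mulrA coefXnM ltnNge (ltnW lt_ij) /=.
  have [r ->] : exists r, (j - i = r.+1)%N by exists (j - i).-1; lia.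
  rewrite (_ : 1 - _ = 2 - (1 + 'X *+ 3)); last by ring.
  rewrite mulrBl -exprS (_ : (2 * r.+1 - 1).+1 = (2 * r.+1))%N; last lia.
  rewrite coefB mulr_natl coefMn !coef_exp_1p3X.
  rewrite (_ : 2 * r.+1 - 1 = (2 * r).+1)%N; last lia.
  rewrite (_ : 2 * r.+1 = (2 * r).+2)%N; last lia.
  rewrite (binS (2 * r).+1) -[in X in _ - X](@bin_sub (2 * r).+1 r); last lia.
  rewrite (_ : (2 * r).+1 - r = r.+1)%N; last lia.
  by rewrite natrD; ring.
- by rewrite -!mulrA coefXnM lt_ji.
rewrite (_ : 2 * j + e - 2 * j = e)%N; last lia.
transitivity (('X^j * (1 - 'X *+ 3) * (1 + 'X *+ 3) ^+ e * geom C J ^+ (e + 1))`_j).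
  by congr (nth _ (polyseq _) _); rewrite addn1; ring.
rewrite coef_geom_cancel // expr1.
rewrite -mulrA coefXnM ltnn subnn mulrBl mul1r coefB mulrnAl coefMn coefXM /= mul0rn subr0.
have := coef_mul_geom C (leq_ltn_trans (leq0n _) jJ).
by rewrite mulrDl mul1r mulrnAl coefB coefD coefMn coefXM /= mul0rn addr0 coef1 => /subr0_eq.
Qed.

(** Expanding ((1 + 3X)^2 - 12X)^t gives the polynomials of [dual_coef_basis], of which only i = j
    survives. *)
Lemma dual_coef_shadow t : (2 * t <= N)%N ->
  dual_coef ((1 + 'X *+ 3) ^+ (N - 2 * t) * (1 - 'X *+ 3) ^+ (2 * t)) = 'C(t, j)%:R * (-12) ^+ j.
Proof.
move=> tN.
have -> : (1 + 'X *+ 3) ^+ (N - 2 * t) * (1 - 'X *+ 3) ^+ (2 * t) =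
  \sum_(i < t.+1) ('C(t, i)%:R * (-12) ^+ i) *: ('X^i * (1 + 'X *+ 3) ^+ (N - 2 * i)) :> {poly C}.
  rewrite exprM (_ : (1 - 'X *+ 3) ^+ 2 = (1 + 'X *+ 3) ^+ 2 + (-12) *: 'X); last first.
    by rewrite -mul_polyC rmorphN rmorph_nat; ring.
  rewrite [X in _ * X = _]exprDn mulr_sumr; apply: eq_bigr => i _.
  have le_it : (i <= t)%N by rewrite -ltnS.
  rewrite (_ : N - 2 * i = (N - 2 * t) + 2 * (t - i))%N; last lia.
  rewrite exprD (exprM _ 2) exprZn -!mul_polyC rmorphM rmorph_nat.
  by rewrite -[_ *+ 'C(_, _)]mulr_natl; ring.
rewrite dual_coef_sum; under eq_bigr => i _.
  rewrite dual_coefZ dual_coef_basis; last by have := ltn_ord i; lia.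
  over.
have [le_jt|lt_tj] := leqP j t.
  rewrite (bigD1 (Ordinal (le_jt : (j < t.+1)%N))) //= eqxx mulr1 big1 ?addr0 //.
  by move=> k; rewrite -val_eqE /= => /negPf->; rewrite mulr0.
rewrite bin_small // mul0r big1 // => k _.
by rewrite ltn_eqF ?mulr0 // (leq_trans (ltn_ord k)).
Qed.

(** Since (1 + X)(1 - 3X) = 1 - 2X - 3X^2, three consecutive coefficients of one series enter. After
    multiplication by j, [ser_rec] eliminates the highest, and the lowest cancels with it. *)
Lemma dual_coef_binomial :
  j%:R * dual_coef ((1 + 'X) ^+ N) = - (2 * N%:R * diag_coef C J j.-1 e.+1).
Proof.
have [n jn] : exists n, j = n.+1 by exists j.-1; lia.
have := ser_rec C (2 * n + e.+1) e.+1 (_ : (n.+1 < J)%N).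
rewrite /dual_coef -jn => /(_ jJ).
set f := ser _ _ _ _.
have -> : (1 + 'X) ^+ N * (1 - 'X *+ 3) * geom C J ^+ e.+1 =
   f - ('X * f) *+ 2 - ('X * ('X * f)) *+ 3.
  rewrite (_ : N = (2 * n + e.+1).+1)%N; last lia.
  by rewrite exprS /f /ser; ring.
rewrite !(coefB, coefMn) (_ : ('X * f)`_j = f`_n); last by rewrite coefXM jn.
rewrite (_ : ('X * ('X * f))`_j = ('X * f)`_n); last by rewrite coefXM jn.
rewrite jn /= /diag_coef -/f !natrD !natrM -!(natr1 n) -!(natr1 e) => H.
rewrite mulrBr mulrBr H; ring.
Qed.

(** For even j, [dual_coef] is nonnegative on the shadow side, but sees only the coefficients up to
    j, where the polynomial is c (1 + X)^N; there its value is a negative multiple of the critical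
    coefficient. *)
Lemma diag_coef_le0 (I : finType) (q : I -> C) (t : I -> nat) (c : C) :
  ~~ odd j -> 0 < c -> (forall i, 0 <= q i) -> (forall i, 2 * t i <= N)%N ->
  (forall s, (s <= j)%N ->
    (\sum_i q i *: ((1 + 'X *+ 3) ^+ (N - 2 * t i) * (1 - 'X *+ 3) ^+ (2 * t i)))`_s
     = c * 'C(N, s)%:R) ->
  diag_coef C J j.-1 e.+1 <= 0.
Proof.
move=> j_even c0 q0 tN fE.
have coefN s : ((1 + 'X : {poly C}) ^+ N)`_s = 'C(N, s)%:R.
  rewrite exprDn coef_sum; under eq_bigr do rewrite expr1n mul1r coefMn coefXn.
  have [le_sn|lt_ns] := leqP s N.
    rewrite (bigD1 (Ordinal (le_sn : (s < N.+1)%N))) //= eqxx big1 ?addr0 //.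
    by move=> k; rewrite -val_eqE /= eq_sym => /negPf->; rewrite mul0rn.
  rewrite bin_small // big1 // => k _.
  by rewrite gtn_eqF ?mul0rn // (leq_trans (ltn_ord k)).
have : 0 <= dual_coef (c *: (1 + 'X) ^+ N).
  rewrite -(@dual_coef_eq (\sum_i q i *: ((1 + 'X *+ 3) ^+ (N - 2 * t i) * (1 - 'X *+ 3) ^+ (2 * t i)))).
    rewrite dual_coef_sum sumr_ge0 // => i _.
    rewrite dual_coefZ dual_coef_shadow // exprNn -signr_odd (negPf j_even) mul1r.
    by rewrite !mulr_ge0 ?exprn_ge0 ?ler0n.
  by move=> s sj; rewrite fE // coefZ coefN.
rewrite dual_coefZ pmulr_rge0 // -(@pmulr_rge0 _ j%:R) ?ltr0n // dual_coef_binomial oppr_ge0.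
by rewrite pmulr_rle0 // mulr_gt0 // ltr0n; lia.
Qed.
End Functional.

(** Positivity is proved over a totally ordered field, the inequality over the complex-like field;
    both are compared in [rat]. *)
Lemma diag_coef_rat (C : numFieldType) J n e : diag_coef C J n e = ratr (diag_coef rat J n e).
Proof.
have mg : map_poly ratr (geom rat J) = geom C J.
  rewrite /geom rmorph_sum; apply: eq_bigr => i _.
  by rewrite rmorphXn rmorphN rmorphMn /= map_polyX.
rewrite /diag_coef /ser -coef_map rmorphM !rmorphXn rmorphD rmorph1 /= map_polyX.
by rewrite mg.
Qed.

(** * Purities and the shadow inequality *)

Section Purity.
Variables (C : numClosedFieldType) (d N : nat).
Local Notation cfg := (config d 'I_N).
Implicit Types (S T A : {set 'I_N}) (x y z w : cfg).

Definition mix S x y : cfg := [ffun i => if i \in S then y i else x i].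

Definition agree S x y := [forall i in S, x i == y i].

Definition symdiff S T := [set i | (i \in S) (+) (i \in T)].

Lemma card_setC_ord S : #|~: S| = (N - #|S|)%N.
Proof. by rewrite cardsCs setCK card_ord. Qed.

Lemma card_cfg : #|{: cfg}| = (d ^ N)%N.
Proof. by rewrite card_ffun !card_ord. Qed.

Lemma mix_mix S x y z : mix S (mix S x y) z = mix S x z.
Proof. by apply/ffunP => i; rewrite !ffunE; case: (i \in S). Qed.

Lemma mix_mixr S x y z : mix S x (mix S y z) = mix S x z.
Proof. by apply/ffunP => i; rewrite !ffunE; case: (i \in S). Qed.

Lemma mix_symdiff S T x y :
  mix (symdiff S T) x y = mix T (mix S x y) (mix S y x).
Proof. by apply/ffunP => i; rewrite !ffunE !inE; case: (i \in S); case: (i \in T). Qed.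

Lemma mixC S x y : mix (~: S) x y = mix S y x.
Proof. by apply/ffunP => i; rewrite !ffunE !inE; case: (i \in S). Qed.

Lemma sum_mix2 S (h : cfg -> cfg -> C) :
  \sum_x \sum_y h (mix S x y) (mix S y x) = \sum_x \sum_y h x y.
Proof.
rewrite !pair_bigA /=; symmetry.
pose g (u : cfg * cfg) := (mix S u.1 u.2, mix S u.2 u.1).
have gK : involutive g.
  by case=> x y; congr (_, _); apply/ffunP => i; rewrite !ffunE; case: (i \in S).
by rewrite (reindex_inj (inv_inj gK)).
Qed.

Lemma sum_mix S (h : cfg -> C) :
  \sum_x \sum_y h (mix S x y) = (d ^ N)%:R * \sum_x h x.
Proof.
rewrite (sum_mix2 S (fun x _ => h x)) mulr_sumr; apply: eq_bigr => x _.
by rewrite sumr_const card_cfg mulr_natl.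
Qed.

Lemma sum_agree S x : \sum_y (agree S x y)%:R = (d ^ (N - #|S|))%:R :> C.
Proof.
have E y : (agree S x y)%:R = \prod_i ((i \in S) ==> (x i == y i))%:R :> C.
  case: (boolP (agree S x y)) => [/forall_inP xy|/forall_inPn[i iS nxy]].
    by rewrite big1 // => i _; case: (boolP (i \in S)) => //= iS; rewrite xy.
  by rewrite (bigD1 i) //= iS (negPf nxy) mul0r.
under eq_bigr do rewrite E.
have -> : \sum_(y : cfg) \prod_i ((i \in S) ==> (x i == y i))%:R =
          \prod_i \sum_a ((i \in S) ==> (x i == a))%:R :> C.
  by rewrite bigA_distr_bigA.
rewrite (bigID (mem S)) /= big1 ?mul1r => [|i iS]; last first.
  rewrite (bigD1 (x i)) //= iS eqxx big1 ?addr0 // => a.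
  by rewrite eq_sym => /negPf ->.
rewrite (eq_bigr (fun=> d%:R)) => [|i /negPf iS]; last first.
  by under eq_bigr do rewrite iS /=; rewrite sumr_const card_ord.
rewrite prodr_const -natrX; congr ((_ ^ _)%:R).
rewrite (eq_card (B := ~: S)) => [|i]; last by rewrite !inE.
exact: card_setC_ord.
Qed.

Variable phi : cfg -> C.

(** Here z runs over all configurations, so each one off A is counted d^#|A| times; this absorbs the
    factor d^-#|A| of the maximally mixed state. *)
Definition marginal_uniform A := forall x y,
  \sum_z phi (mix A z x) * (phi (mix A z y))^* = (agree A x y)%:R.

(* The expectation of the swap of the two copies of the parties in S, i.e. the
   trace of the square of the reduced state on S. *)
Definition purity S := \sum_x \sum_y
  (phi x * phi y) * (phi (mix S x y) * phi (mix S y x))^*.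

Hypothesis d_gt0 : (0 < d)%N.

Let dN_neq0 : (d ^ N)%:R != 0 :> C.
Proof. by rewrite pnatr_eq0 expn_eq0 negb_and -lt0n d_gt0. Qed.

(** Resample the coordinates in A by an independent v: for fixed v, the sum over z is the hypothesis
    on A at two configurations that agree off S. *)
Lemma marginal_uniformS A S : S \subset A -> marginal_uniform A -> marginal_uniform S.
Proof.
move=> sSA uA x y; apply: (mulfI dN_neq0).
rewrite -(sum_mix A) exchange_big /=.
have mixS v z u : mix S (mix A z v) u = mix A z (mix S v u).
  apply/ffunP => i; rewrite !ffunE.
  by case: ifP => // iS; rewrite (subsetP sSA _ iS).
rewrite -[in RHS]card_cfg mulr_natl -sumr_const; apply: eq_bigr => v _.
under eq_bigr do rewrite !mixS.
rewrite uA; congr ((nat_of_bool _)%:R); apply/forall_inP/forall_inP => H i iS.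
  by have := H i (subsetP sSA _ iS); rewrite !ffunE iS.
by rewrite !ffunE; case: ifP => // /H.
Qed.

(** Doubling both sums separates the parts on S, x and y, from the parts off S, z and w. For fixed x
    and y the sum over z and w is a product of two marginals. *)
Lemma purity_uniform S : marginal_uniform S -> (d ^ #|S|)%:R * purity S = 1.
Proof.
move=> uS; set D : C := (d ^ N)%:R.
have cS : (#|S| <= N)%N by rewrite -[X in (_ <= X)%N]card_ord max_card.
have DE : D = (d ^ #|S|)%:R * (d ^ (N - #|S|))%:R.
  by rewrite /D -natrM -expnD subnKC.
suff H : D * D * purity S = D * (d ^ (N - #|S|))%:R.
  apply: (mulfI (mulf_neq0 dN_neq0 dN_neq0)); rewrite -/D mulr1.
  by rewrite mulrCA H mulrCA -DE.
pose h x y := phi x * phi y * (phi (mix S x y) * phi (mix S y x))^*.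
have -> : D * D * purity S =
    \sum_z \sum_x \sum_w \sum_y h (mix S z x) (mix S w y).
  rewrite -mulrA /purity -(sum_mix S (fun x => \sum_y h x y)) mulr_sumr.
  apply: eq_bigr => z _; rewrite mulr_sumr; apply: eq_bigr => x _.
  by rewrite (sum_mix S (h (mix S z x))).
have -> : D * (d ^ (N - #|S|))%:R = \sum_x \sum_y (agree S x y)%:R.
  under [in RHS]eq_bigr do rewrite sum_agree.
  by rewrite sumr_const card_cfg mulr_natl.
rewrite exchange_big /=; apply: eq_bigr => x _.
under eq_bigr => z _ do rewrite exchange_big /=.
rewrite exchange_big /=; apply: eq_bigr => y _.
have agreeC : agree S y x = agree S x y by apply: eq_forallb_in => i _; rewrite eq_sym.
transitivity ((agree S x y)%:R * (agree S y x)%:R : C); last first.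
  by rewrite agreeC; case: (agree S x y); rewrite ?mulr1 ?mulr0.
rewrite -(uS x y) -(uS y x) mulr_suml; apply: eq_bigr => z _.
rewrite mulr_sumr; apply: eq_bigr => w _.
rewrite /h !mix_mix !mix_mixr rmorphM /=; ring.
Qed.

(** The character (-1)^#|S :&: T|, as a product over the parties so that sums over T factor in
    [shadow_poly]. *)
Definition chi T S : C := \prod_i (if (i \in S) && (i \in T) then -1 else 1).

(* Up to the factor 2^N, the squared norm of the projection of phi (x) phi that
   is antisymmetric under the swap on the parties in T and symmetric on the
   other ones. *)
Definition shadow T := \sum_S chi T S * purity S.

Lemma chi_symdiff T S U : chi T (symdiff S U) = chi T S * chi T U.
Proof.
rewrite /chi -big_split; apply: eq_bigr => i _ /=; rewrite !inE.
by case: (i \in S); case: (i \in U); case: (i \in T); rewrite /= ?mulrNN ?mulN1r ?mulr1 ?mulNr ?mul1r.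
Qed.

Lemma chi_real T S : (chi T S)^* = chi T S.
Proof.
rewrite /chi rmorph_prod; apply: eq_bigr => i _.
by case: ifP; rewrite ?rmorphN rmorph1.
Qed.

Lemma chi_sqr T S : chi T S * chi T S = 1.
Proof. by rewrite /chi -big_split big1 //= => i _; case: ifP; rewrite ?mulrNN mulr1. Qed.

Lemma chiC T S : chi T (~: S) = (-1) ^+ #|T| * chi T S.
Proof.
have -> : (-1) ^+ #|T| = \prod_i (if i \in T then -1 else 1) :> C.
  by rewrite -big_mkcond prodr_const.
rewrite /chi -big_split; apply: eq_bigr => i _ /=; rewrite !inE.
by case: (i \in S); case: (i \in T); rewrite /= ?mulrNN ?mulr1.
Qed.

Lemma purityC S : purity (~: S) = purity S.
Proof.
rewrite /purity; apply: eq_bigr => x _; apply: eq_bigr => y _.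
by rewrite !mixC [phi (mix S y x) * _]mulrC.
Qed.

(** Complementing S preserves the purity and multiplies the character by (-1)^#|T|, so the shadow is
    its own opposite. *)
Lemma shadow_odd T : odd #|T| -> shadow T = 0.
Proof.
move=> oT; apply/eqP; have := mulrn_eq0 (shadow T) 2; rewrite /= => <-; rewrite mulr2n; apply/eqP.
rewrite {1}/shadow (reindex_inj (inv_inj (@setCK _))) /= -big_split /=.
rewrite big1 // => S _.
by rewrite chiC purityC -signr_odd oT expr1 mulN1r mulNr addNr.
Qed.

(** Swaps compose by symmetric difference and [chi T] is a character. Hence the squared norm of w,
    the sum of the swapped vectors weighted by [chi T], is 2^N copies of the shadow. *)
Lemma shadow_ge0 T : 0 <= shadow T.
Proof.
pose v S x y := phi (mix S x y) * phi (mix S y x).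
have vS S U x y : v (symdiff S U) x y = v U (mix S x y) (mix S y x).
  by rewrite /v !mix_symdiff.
have symdiffK S : involutive (symdiff S).
  by move=> U; apply/setP => i; rewrite !inE addbA addbb.
pose w x y := \sum_S chi T S * v S x y.
suff H : (2 ^ N)%:R * shadow T = \sum_x \sum_y w x y * (w x y)^*.
  rewrite -(@pmulr_rge0 _ (2 ^ N)%:R) ?ltr0n ?expn_gt0 // H.
  by apply: sumr_ge0 => x _; apply: sumr_ge0 => y _; apply: mul_conjC_ge0.
transitivity (\sum_S \sum_U \sum_x \sum_y
    chi T S * v S x y * (chi T U * v U x y)^*); last first.
  rewrite -[LHS](eq_bigr _ (fun S _ => exchange_big _ _ _ _ _ _)) exchange_big.
  apply: eq_bigr => x _.
  rewrite -[LHS](eq_bigr _ (fun S _ => exchange_big _ _ _ _ _ _)) exchange_big.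
  apply: eq_bigr => y _.
  rewrite /w mulr_suml; apply: eq_bigr => S _.
  by rewrite rmorph_sum mulr_sumr.
have -> : (2 ^ N)%:R * shadow T = \sum_(S : {set 'I_N}) shadow T.
  by rewrite sumr_const -cardsT -powersetT card_powerset cardsT card_ord mulr_natl.
apply: eq_bigr => S _.
rewrite (reindex_inj (inv_inj (symdiffK S))) /shadow; apply: eq_bigr => U _.
rewrite /purity -(sum_mix2 S) mulr_sumr; apply: eq_bigr => x _.
rewrite mulr_sumr; apply: eq_bigr => y _.
rewrite chi_symdiff vS [X in _ = _ * X]rmorphM /= [(chi T S * _)^*]rmorphM /= !chi_real.
rewrite -/(v S x y) -/(v U _ _).
have := chi_sqr T S; move: (chi T S) (chi T U) (v S x y) (_^* ) => a b c e H.
by rewrite -[LHS]mul1r -H; ring.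
Qed.

(** For fixed S the sum over T factors over the parties, each giving (1 + z) - (1 - z) = 2z in S and
    (1 + z) + (1 - z) = 2 off S. *)
Lemma shadow_poly (z : {poly C}) :
  \sum_T shadow T *: ((1 + z) ^+ (N - #|T|) * (1 - z) ^+ #|T|) =
  (2 ^ N)%:R * \sum_S purity S *: z ^+ #|S|.
Proof.
have termE T S : chi T S *: ((1 + z) ^+ (N - #|T|) * (1 - z) ^+ #|T|) =
  \prod_i (if i \in T then (if i \in S then -1 else 1) * (1 - z) else 1 + z).
  rewrite (bigID (mem T)) /=.
  rewrite (eq_bigr (fun i => (if i \in S then -1 else 1) * (1 - z))); last by move=> i ->.
  rewrite [X in _ = _ * X](eq_bigr (fun=> 1 + z)); last by move=> i iT; rewrite ifN.
  rewrite [X in _ = _ * X](eq_bigl (fun i => i \in ~: T)); last by move=> i; rewrite in_setC.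
  rewrite big_split /= !prodr_const.
  rewrite card_setC_ord.
  rewrite -mulrA [_ ^+ #|T| * _]mulrC -mul_polyC; congr (_ * _).
  rewrite /chi rmorph_prod [RHS]big_mkcond; apply: eq_bigr => i _ /=.
  by case: (i \in S); case: (i \in T); rewrite /= ?rmorphN rmorph1.
transitivity (\sum_S purity S *: \sum_T
    (chi T S *: ((1 + z) ^+ (N - #|T|) * (1 - z) ^+ #|T|))).
  rewrite [RHS](eq_bigr _ (fun S _ => scaler_sumr _ _ _ _)) exchange_big.
  apply: eq_bigr => T _; rewrite /shadow scaler_suml; apply: eq_bigr => S _.
  by rewrite scalerA mulrC.
rewrite mulr_sumr; apply: eq_bigr => S _.
rewrite (eq_bigr _ (fun T _ => termE T S)) -scalerAr; congr (_ *: _).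
transitivity (\prod_i ((if i \in S then -1 else 1) * (1 - z) + (1 + z))).
  by rewrite bigA_distr.
rewrite (eq_bigr (fun i => 2 * (if i \in S then z else 1))) => [|i _]; last by case: (i \in S); ring.
by rewrite big_split /= prodr_const card_ord -natrX -big_mkcond prodr_const.
Qed.
End Purity.

(** * Inequalities forced by uniform marginals *)

Section Bounds.
Variables (C : numClosedFieldType) (N : nat) (phi : config 3 'I_N -> C).

(* A set and its complement have the same purity. *)
Lemma marginal_uniform_half k : (k <= N)%N ->
  (forall A : {set 'I_N}, (#|A| <= k)%N -> marginal_uniform phi A) -> (2 * k <= N)%N.
Proof.
move=> kN uphi; rewrite leqNgt; apply/negP => ltN.
have [A cA] : exists A : {set 'I_N}, #|A| = k.
  exists [set widen_ord kN i | i : 'I_k]; rewrite card_imset ?card_ord //.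
  by move=> i i' /(congr1 val) /= /val_inj.
have cA' : #|~: A| = (N - k)%N by rewrite card_setC_ord cA.
have := purity_uniform (isT : (0 < 3)%N) (uphi A (_ : #|A| <= k)%N); rewrite cA => /(_ (leqnn k)) E1.
have := purity_uniform (isT : (0 < 3)%N) (uphi (~: A) (_ : #|~: A| <= k)%N).
rewrite cA' purityC => /(_ ltac:(lia)) E2.
have p0 : purity phi A != 0.
  by apply: contra_eq_neq E1 => ->; rewrite mulr0 eq_sym oner_eq0.
have /(mulIf p0) /eqP : (3 ^ k)%:R * purity phi A = (3 ^ (N - k))%:R * purity phi A by rewrite E1 E2.
rewrite eqr_nat eqn_exp2l //; lia.
Qed.

(** At z = 3X every set of size s <= j contributes 3^s times its purity, which is 1, so the
    coefficient of X^s is 2^N C(N, s). *)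
Lemma marginal_uniform_diag_coef_le0 j J : (0 < j < J)%N -> ~~ odd j -> (2 * j <= N)%N ->
  (forall A : {set 'I_N}, (#|A| <= j)%N -> marginal_uniform phi A) ->
  diag_coef rat J j.-1 (N - 2 * j).+1 <= 0.
Proof.
move=> /andP[j0 jJ] j_even jN uphi.
rewrite -(@lerq0 C) -diag_coef_rat.
have NE : (2 * j + (N - 2 * j))%N = N by rewrite subnKC.
(* Zeroing the odd terms, which vanish by [shadow_odd], lets the exponent #|T| be written as twice
   its half. *)
pose q (T : {set 'I_N}) : C := if odd #|T| then 0 else shadow phi T.
apply: (@diag_coef_le0 C J j _ jJ j0 _ q (fun T => #|T|./2) (2 ^ N)%:R) => //.
- by rewrite ltr0n expn_gt0.
- by move=> T; rewrite /q; case: ifP => // _; apply: shadow_ge0.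
- move=> T; rewrite NE mul2n.
  by apply: leq_trans (_ : #|T| <= N)%N; [lia | rewrite -[X in (_ <= X)%N]card_ord max_card].
move=> s sj; rewrite NE.
transitivity (((2 ^ N)%:R * \sum_S purity phi S *: ('X *+ 3) ^+ #|S| : {poly C})`_s).
  congr (nth _ (polyseq _) _); rewrite -shadow_poly; apply: eq_bigr => T _.
  rewrite /q; case: ifP => oT; first by rewrite (shadow_odd _ oT) !scale0r.
  by rewrite (_ : 2 * #|T|./2 = #|T|)%N //; lia.
have coef_natM n (p : {poly C}) i : (n%:R * p)`_i = n%:R * p`_i.
  by rewrite !mulr_natl coefMn.
rewrite coef_natM coef_sum; congr (_ * _).
rewrite (bigID (fun S : {set 'I_N} => #|S| == s)) /= [X in _ + X]big1 ?addr0 => [|S nS]; last first.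
  by rewrite coefZ exprMn_n coefMn coefXn eq_sym (negPf nS) mul0rn mulr0.
rewrite (eq_bigr (fun=> 1)) => [|S /eqP cS]; last first.
  rewrite coefZ exprMn_n coefMn coefXn cS eqxx -cS mulrC.
  by apply: (purity_uniform (isT : (0 < 3)%N)); apply: uphi; rewrite cS.
rewrite sumr_const -[in RHS](card_ord N) -card_draws; congr (_%:R).
by apply: eq_card => S; rewrite !inE.
Qed.
End Bounds.

(** * Reduced states *)

(** The free index [b'] permits case analysis on the [boolP] inside [glue], and proof irrelevance
    identifies the membership proofs. *)
Lemma alt_spec_true (T : Type) (b b' : bool) (f : b -> T) (g : ~~ b -> T) (h : b)
    (s : alt_spec b b b') :
  match s with AltTrue p => f p | AltFalse q => g q end = f h.
Proof. by case: s => [p|/negP//]; rewrite (bool_irrelevance p h). Qed.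

Lemma alt_spec_false (T : Type) (b b' : bool) (f : b -> T) (g : ~~ b -> T) (h : ~~ b)
    (s : alt_spec b b b') :
  match s with AltTrue p => f p | AltFalse q => g q end = g h.
Proof. by case: s => [p|q]; [case/negP: (h) | rewrite (bool_irrelevance q h)]. Qed.

Section Reduced.
Variables (C : numClosedFieldType) (d N : nat) (A : {set 'I_N}).
Local Notation cfg := (config d 'I_N).

Definition restr (x : cfg) : config d {i : 'I_N | i \in A} := [ffun i => x (val i)].
Definition corestr (x : cfg) : config d {i : 'I_N | i \notin A} := [ffun i => x (val i)].

Lemma glue_in a c (i : {i : 'I_N | i \in A}) : glue a c (val i) = a i :> 'I_d.
Proof. by case: i => i iA /=; rewrite ffunE; apply: alt_spec_true (boolP _). Qed.

Lemma glue_notin a c (i : {i : 'I_N | i \notin A}) : glue a c (val i) = c i :> 'I_d.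
Proof. by case: i => i iA /=; rewrite ffunE; apply: alt_spec_false (boolP _). Qed.

Lemma glue_restr x : glue (restr x) (corestr x) = x.
Proof.
apply/ffunP => i; have [iA|iA] := boolP (i \in A).
  by rewrite (glue_in _ _ (exist _ i iA)) ffunE.
by rewrite (glue_notin _ _ (exist _ i iA)) ffunE.
Qed.

Lemma restr_glue a c : restr (glue a c) = a.
Proof. by apply/ffunP => i; rewrite ffunE glue_in. Qed.

Lemma corestr_glue a c : corestr (glue a c) = c.
Proof. by apply/ffunP => i; rewrite ffunE glue_notin. Qed.

Lemma mix_glue a c x : mix A (glue a c) x = glue (restr x) c.
Proof.
apply/ffunP => i; rewrite [LHS]ffunE; case: ifPn => iA.
  by rewrite (glue_in _ _ (exist _ i iA)) ffunE.
by rewrite !(glue_notin _ _ (exist _ i iA)).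
Qed.

Lemma restr_eq x y : (restr x == restr y) = agree A x y.
Proof.
apply/eqP/forall_inP => [/ffunP rxy i iA|xy].
  by have := rxy (exist _ i iA); rewrite !ffunE => /eqP.
by apply/ffunP => -[i iA]; rewrite !ffunE; apply/eqP/xy.
Qed.

(** Through [glue], z splits into a part on A, on which the summand does not depend, and a traced
    part; the former contributes the cancelling factor d^#|A|. *)
Lemma reduced_uniform (psi : tensor_space C d 'I_N) : (0 < d)%N ->
  reduced A (density psi) = (1 / d%:R ^+ #|A|)%:M ->
  marginal_uniform (fun x => psi (enum_rank x) 0) A.
Proof.
move=> d0 uA x y.
have /matrixP/(_ (enum_rank (restr x)) (enum_rank (restr y))) := uA.
rewrite !mxE !enum_rankK (inj_eq enum_rank_inj) restr_eq => uAxy.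
pose g (u : config d {i : 'I_N | i \in A} * config d {i : 'I_N | i \notin A}) := glue u.1 u.2.
rewrite (reindex g) /=; last first.
  exists (fun z => (restr z, corestr z)) => [[a c]|z] _; last exact: glue_restr.
  by rewrite /g /= restr_glue corestr_glue.
rewrite -(pair_bigA _ (fun a c => psi (enum_rank (mix A (glue a c) x)) 0 *
   (psi (enum_rank (mix A (glue a c) y)) 0)^* )) /=.
rewrite (eq_bigr (fun=> (1 / d%:R ^+ #|A|) *+ agree A x y)) => [|a _]; last first.
  rewrite -uAxy; apply: eq_bigr => c _.
  by rewrite !mix_glue /density !mxE big_ord1 !mxE.
rewrite sumr_const card_ffun card_ord card_sig.
rewrite -mulrnA mulnC mulrnA -[_ *+ (_ ^ _)]mulr_natr natrX div1r mulVf //.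
by rewrite expf_neq0 // pnatr_eq0 -lt0n.
Qed.
End Reduced.

(** * From uniform states to bounds on k *)

Lemma k_uniform_marginal (C : numClosedFieldType) (d N k : nat)
    (psi : tensor_space C d 'I_N) : (0 < d)%N -> (k <= N)%N -> k_uniform k psi ->
  forall A : {set 'I_N}, (#|A| <= k)%N ->
  marginal_uniform (fun x => psi (enum_rank x) 0) A.
Proof.
move=> d0 kN upsi A cA.
have [B sAB cB] : exists2 B : {set 'I_N}, A \subset B & #|B| = k.
  have [n nE] : exists n, n = (k - #|A|)%N by eexists.
  elim: n A cA nE => [|n IH] A cA nE; first by exists A => //; lia.
  have /set0Pn[x] : ~: A != set0 by rewrite -card_gt0 card_setC_ord; lia.
  rewrite inE => xA; have cxA : #|x |: A| = #|A|.+1 by rewrite cardsU1 xA.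
  have [||B sB cB] := IH (x |: A); rewrite ?cxA; try lia.
  by exists B => //; apply: subset_trans sB; apply: subsetUr.
apply: (marginal_uniformS d0 sAB); apply: reduced_uniform => //.
by rewrite cB; apply: upsi.
Qed.

(** If j <= k, all marginals on at most j parties are uniform and 2j <= N, so the coefficient would
    be nonpositive. Truncation at [j.+1] keeps degree j exact. *)
Lemma k_uniform_lt (C : numClosedFieldType) (N k j : nat)
    (psi : tensor_space C 3 'I_N) : (k <= N)%N -> k_uniform k psi ->
  (0 < j)%N -> ~~ odd j ->
  ((2 * j <= N)%N -> 0 < diag_coef rat j.+1 j.-1 (N - 2 * j).+1) -> (k < j)%N.
Proof.
move=> kN /(k_uniform_marginal (isT : (0 < 3)%N) kN) uphi j0 j_even coef_gt0.
rewrite ltnNge; apply/negP => jk.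
have jN : (2 * j <= N)%N by have := marginal_uniform_half kN uphi; lia.
have := coef_gt0 jN; rewrite ltNge => /negP; apply.
have jJ : (0 < j < j.+1)%N by rewrite j0 /=.
apply: (marginal_uniform_diag_coef_le0 jJ j_even jN (phi := fun x => psi (enum_rank x) 0)).
by move=> A cA; apply: uphi; apply: leq_trans jk.
Qed.

Local Close Scope ring_scope.

Theorem theorem8 (R : realType) (m N k : nat) (hm : (1 <= m)%N)
    (hN : N \notin [:: 23; 37; 51]) (hk : (k <= N)%N)
    (hpsi : exists psi : tensor_space R[i] 3 'I_N,
        pure_state psi /\ k_uniform k psi) :
  ((14 * m - 4 <= N <= 14 * m - 1)%N -> (k <= 6 * m - 1)%N) /\
  ((14 * m <= N <= 14 * m + 4)%N -> (k <= 6 * m + 1)%N) /\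
  ((14 * m + 5 <= N <= 14 * m + 9)%N -> (k <= 6 * m + 3)%N).
Proof.
have [psi [_ upsi]] := hpsi.
split; [|split] => hNm.
(* The three values of j are even and one above the claimed bounds. *)
- suff: (k < 6 * m)%N by lia.
  apply: (k_uniform_lt hk upsi); [lia | lia |] => jN.
  by rewrite -subn1; apply: diag_coef_6mB1_gt0; lia.
- suff: (k < 6 * m + 2)%N by lia.
  apply: (k_uniform_lt hk upsi); [lia | lia |] => jN.
  rewrite (_ : (6 * m + 2).-1 = 6 * m + 1)%N; last lia.
  by apply: diag_coef_6mD1_gt0; lia.
- suff: (k < 6 * m + 4)%N by lia.
  apply: (k_uniform_lt hk upsi); [lia | lia |] => jN.
  rewrite (_ : (6 * m + 4).-1 = 6 * m + 3)%N; last lia.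
  (* For m = 1, 2, 3 the value N = 14m + 9 is 23, 37, 51, excluded by [hN]. *)
  by apply: diag_coef_6mD3_gt0; move: hN; rewrite ?inE; lia.
Qed.
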